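(* Let $Y\subseteq\ell_1^n$ be a linear subspace of the complex $\ell_1^n$ space. Suppose that $y_0\in Y$ is a unique best approximation in $Y$ for a vector $x\in\ell_1^n$. Then $y_0$ is a $2$-strongly unique best approximation for $x$ in $Y$.
   Context: The complex space $\ell_1^n$ is $\mathbb{C}^n$ with norm $\|x\|_1=|x_1|+\dots+|x_n|$; $n\ge2$, and ''linear subspace'' means a proper nonzero linear subspace. For a linear subspace $Y$ of a normed space $X$ and $x\in X$, a vector $y_0\in Y$ is a best approximation for $x$ in $Y$ if $\|x-y\|\ge\|x-y_0\|$ for all $y\in Y$; it is unique if no other element of $Y$ has this property. For a real $\alpha\ge1$, $y_0\in Y$ is an $\alpha$-strongly unique best approximation for $x$ in $Y$ if there is $r>0$ with $\|x-y\|^\alpha\ge\|x-y_0\|^\alpha+r\|y-y_0\|^\alpha$ for all $y\in Y$. *)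

(* Defs.v *)
From HB Require Import structures.
From mathcomp Require Import all_boot all_order all_algebra.
From mathcomp Require Import complex.
From mathcomp Require Import reals exp.

Set Implicit Arguments.
Unset Strict Implicit.
Unset Printing Implicit Defensive.

Import Order.TTheory GRing.Theory Num.Theory.
Import ComplexField.Normc.
Local Open Scope ring_scope.
Local Open Scope complex_scope.

(* The alias keeps the l1 norm apart from the sup norm that MathComp-Analysis
   puts on matrices. The norm is real-valued: l1 R n is a normedZmodType R and,
   for its linear structure, a vectType R[i]. *)
Definition l1 (R : realType) (n : nat) : Type := 'rV[R[i]]_n.

HB.instance Definition _ (R : realType) (n : nat) :=
  Vector.on (l1 R n).

Section L1Norm.
Variables (R : realType) (n : nat).
Implicit Types x y : l1 R n.

Definition l1norm x : R := \sum_(j < n) normc (x ord0 j).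

Fact ler_l1normD x y : l1norm (x + y) <= l1norm x + l1norm y.
Proof.
rewrite /l1norm -big_split /=; apply: ler_sum => j _.
by rewrite mxE; exact: le_normcD.
Qed.

Fact l1norm_eq0 x : l1norm x = 0 -> x = 0.
Proof.
move=> /eqP; rewrite psumr_eq0 => [/allP x0|j _]; last first.
  by case: (x _ _) => a b; exact: sqrtr_ge0.
apply/rowP => j; rewrite mxE; apply: eq0_normc; apply/eqP.
by apply: x0; rewrite mem_index_enum.
Qed.

Fact l1normMn x k : l1norm (x *+ k) = l1norm x *+ k.
Proof.
rewrite /l1norm -sumrMnl; apply: eq_bigr => j _.
by rewrite mulmxnE normcMn.
Qed.

Fact l1normN x : l1norm (- x) = l1norm x.
Proof. by apply: eq_bigr => j _; rewrite mxE normcN. Qed.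

HB.instance Definition _ := Num.Zmodule_isNormed.Build R (l1 R n)
  ler_l1normD l1norm_eq0 l1normMn l1normN.

Lemma l1normE x : `|x| = \sum_(j < n) normc (x ord0 j).
Proof. by []. Qed.

Lemma l1normZ (a : R[i]) x : `|a *: x| = normc a * `|x|.
Proof.
by rewrite !l1normE mulr_sumr; apply: eq_bigr => j _; rewrite mxE normcM.
Qed.

End L1Norm.

Section BestApproximation.
Variables (R : realType) (X : normedZmodType R).
Implicit Types (Y : {pred X}) (x y : X).

Definition best_approximation Y x (y0 : X) : Prop :=
  y0 \in Y /\ forall y, y \in Y -> `|x - y0| <= `|x - y|.

Definition unique_best_approximation Y x (y0 : X) : Prop :=
  best_approximation Y x y0 /\
  forall y, best_approximation Y x y -> y = y0.

(* Intended for exponents alpha >= 1. *)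
Definition strongly_unique_best_approximation (alpha : R) Y x (y0 : X) : Prop :=
  y0 \in Y /\
  exists r : R, 0 < r /\
    forall y, y \in Y ->
      `|x - y0| `^ alpha + r * `|y - y0| `^ alpha <= `|x - y| `^ alpha.

End BestApproximation.

(* Main.v *)
(** Put z = x - y0. For y in Y let D y be the one-sided derivative of
    s |-> |z - s y| at 0+, and let Q y be the sum of Im(conj z_j y_j)^2/|z_j|^2
    over the j with z_j <> 0. Optimality of y0 gives D >= 0 on Y. If D y = 0
    and Q y = 0, then z - s y has the same norm as z for small s > 0, so that
    y = 0 by uniqueness; hence D + Q > 0 off 0, and by compactness D + c Q is
    bounded below on the unit sphere of Y by a constant k > 0. As
    |z - y| >= |z| + D y + Q y / (2 (|z| + |y|)), where D has degree 1 and
    Q degree 2, |z - y| exceeds |z| by at least k |y|^2 for small y and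
    k |y| for large y; squaring gives the claim, since z <> 0 without loss of
    generality. *)

Require Import Defs.
From mathcomp Require Import all_boot all_order all_algebra.
From mathcomp Require Import complex.
From mathcomp Require Import reals exp.
From mathcomp Require Import boolp classical_sets topology normedtype derive.
From mathcomp Require Import realfun ring lra.

Set Implicit Arguments.
Unset Strict Implicit.
Unset Printing Implicit Defensive.

Import Order.TTheory GRing.Theory Num.Theory numFieldNormedType.Exports.
Import ComplexField.Normc.
Local Open Scope ring_scope.

(** * Expansion of the modulus of [z - w] in one complex coordinate *)

Section ComplexModulus.
Variable R : realType.
Implicit Types (z w : R[i]) (s B : R).

(* The derivative of s |-> normc (z - s w) at 0+; the second term is 0 when
   z = 0, because 0^-1 = 0. *)
Definition normc_slope z w : R :=
  (z == 0)%:R * normc w - complex.Re (z^*%C * w) / normc z.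

(* The component of w orthogonal to z, and 0 when z = 0. *)
Definition normc_drift z w : R := complex.Im (z^*%C * w) / normc z.

Lemma normc_ge0 z : 0 <= normc z.
Proof. by case: z => a b; exact: sqrtr_ge0. Qed.

Lemma sqr_normcE z : normc z ^+ 2 = complex.Re z ^+ 2 + complex.Im z ^+ 2.
Proof. by case: z => a b; rewrite sqr_sqrtr ?addr_ge0 ?sqr_ge0. Qed.

Lemma normcZ s w : normc (s%:C%C * w) = `|s| * normc w.
Proof. by rewrite normcM /= expr0n addr0 sqrtr_sqr. Qed.

Lemma normc_gt0 z : (0 < normc z) = (z != 0).
Proof.
rewrite lt0r normc_ge0 andbT; congr negb; apply/eqP/eqP => [/eq0_normc//|->].
exact: normc0.
Qed.

Lemma normc_slope0 w : normc_slope 0 w = normc w.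
Proof. by rewrite /normc_slope eqxx normc0 invr0 mulr0 subr0 mul1r. Qed.

Lemma normc_drift0 w : normc_drift 0 w = 0.
Proof. by rewrite /normc_drift normc0 invr0 mulr0. Qed.

Lemma normc_slopeZ z s w : 0 <= s ->
  normc_slope z (s%:C%C * w) = s * normc_slope z w.
Proof.
move=> s0; rewrite /normc_slope normcZ ger0_norm //.
case: z w => p q [c d] /=; ring.
Qed.

Lemma normc_driftZ z s w :
  normc_drift z (s%:C%C * w) = s * normc_drift z w.
Proof. rewrite /normc_drift; case: z w => p q [c d] /=; ring. Qed.

(** Multiplication by the unit number conj(z)/|z| is an isometry; it sends [w] to the number with
    real part minus the slope and imaginary part the drift. *)
Lemma sqr_normc_polar z w : z != 0 ->
  normc w ^+ 2 = normc_slope z w ^+ 2 + normc_drift z w ^+ 2.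
Proof.
move=> z0; have := sqr_normcE z; have := z0; rewrite -normc_gt0.
rewrite /normc_slope /normc_drift (negbTE z0) mul0r sub0r (sqr_normcE w).
set a := normc z; case: z w {z0} @a => p q [c d] a /= a0 a2.
have a_neq0 : a != 0 by rewrite gt_eqF.
have -> : (- ((p * c - - q * d) / a)) ^+ 2 + ((p * d + - q * c) / a) ^+ 2 =
  ((p ^+ 2 + q ^+ 2) * (c ^+ 2 + d ^+ 2)) / a ^+ 2 by field.
by rewrite -a2; field.
Qed.

(** The rotation by conj(z)/|z| sends [z] to |z|, so [z - w] acquires real part |z| plus the slope,
    and minus the drift as imaginary part. *)
Lemma sqr_normcB_polar z w : z != 0 ->
  normc (z - w) ^+ 2
  = (normc z + normc_slope z w) ^+ 2 + normc_drift z w ^+ 2.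
Proof.
move=> z0.
rewrite sqrrD -addrA -sqr_normc_polar //.
rewrite (sqr_normcE (_ - _)) (sqr_normcE w) (sqr_normcE z).
rewrite /normc_slope (negbTE z0) mul0r sub0r.
rewrite -normc_gt0 in z0; move: z0; set a := normc z.
case: z w @a => p q [c d] a /= a0.
have a_neq0 : a != 0 by rewrite gt_eqF.
by field.
Qed.

Lemma normcB_ge z w B : 0 < B -> normc z + normc w <= B ->
  normc z + normc_slope z w + normc_drift z w ^+ 2 / (2 * B)
  <= normc (z - w).
Proof.
move=> B0 leB; have [->|z0] := eqVneq z 0.
  by rewrite normc_slope0 normc_drift0 normc0 sub0r normcN expr0n mul0r add0r
    addr0.
have n2 := sqr_normcB_polar w z0; have n0 := normc_ge0 (z - w).
have nB : normc (z - w) <= B.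
  by apply: le_trans leB; rewrite -(normcN w); exact: le_normcD.
set n := normc (z - w) in n2 n0 nB *; set v := normc_drift z w in n2 *.
set b := normc z + _ in n2 *.
have bn : b <= n.
  have [b0|b0] := leP b 0; first exact: le_trans n0.
  by rewrite -ler_sqr ?nnegrE ?(ltW b0) // n2 lerDl sqr_ge0.
rewrite -lerBrDl ler_pdivrMr ?mulr_gt0 //.
(* Since (n - b)(n + b) is the squared drift, bounding n + b by 2B turns the exact square formula
   into the claimed gain n - b. *)
have : 0 <= (n - b) * (2 * B - (n + b)) by apply: mulr_ge0; lra.
nra.
Qed.

Lemma normcB_le z w s : 0 <= s -> 2 * s * normc w <= normc z \/ z = 0 ->
  normc (z - s%:C%C * w)
  <= normc z + s * normc_slope z w + s ^+ 2 * (normc_drift z w ^+ 2 / normc z).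
Proof.
move=> s0.
have [->|z0] := eqVneq z 0.
  rewrite normc_slope0 normc_drift0 sub0r normcN normcZ normc0 ger0_norm //.
  by rewrite expr0n mul0r mulr0 addr0 add0r.
case=> [sw|zE]; last by rewrite zE eqxx in z0.
have := sqr_normcB_polar (s%:C%C * w) z0.
rewrite normc_slopeZ // normc_driftZ.
have w2 := sqr_normc_polar w z0; have w0 := normc_ge0 w.
move: z0; rewrite -normc_gt0.
set a := normc z in sw *; set u := normc_slope z w in w2 *.
set v := normc_drift z w in w2 *; set n := normc (z - _) => a0 n2.
have uw : - normc w <= u.
  rewrite lerNl; have [|] := leP (- u) 0; first by move/le_trans; apply.
  by move=> u0; rewrite -ler_sqr ?nnegrE ?(ltW u0) // sqrrN w2 lerDl sqr_ge0.
(* With e the quadratic term, this gives (a + su + e)^2 >= (a + su)^2 + ae, and the right side is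
   n^2. The smallness of s serves only to keep a + su at least a/2. *)
have su : a <= 2 * (a + s * u) by nra.
set e := s ^+ 2 * (v ^+ 2 / a).
have e0 : 0 <= e by rewrite mulr_ge0 ?sqr_ge0 // divr_ge0 ?sqr_ge0 // ltW.
rewrite -ler_sqr ?nnegrE ?normc_ge0 //; last by apply: addr_ge0 => //; lra.
rewrite n2; have -> : (s * v) ^+ 2 = a * e by rewrite /e; field; rewrite gt_eqF.
nra.
Qed.

Lemma normc_Complex_le (p q : R) : normc (Complex p q) <= `|p| + `|q|.
Proof.
rewrite -ler_sqr ?nnegrE ?normc_ge0 ?addr_ge0 // sqr_normcE /= sqrrD !real_normK
  ?num_real //.
by rewrite lerD2r lerDl mulrn_wge0 // mulr_ge0.
Qed.

End ComplexModulus.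

(** * Summation over the coordinates, and what optimality and uniqueness say about slope and
    drift *)

Section L1Expansion.
Variables (R : realType) (n : nat).
Implicit Types (x y z : l1 R n) (s B : R).

Definition l1_slope z y : R :=
  \sum_(j < n) normc_slope (z ord0 j) (y ord0 j).

Definition l1_drift z y : R :=
  \sum_(j < n) normc_drift (z ord0 j) (y ord0 j) ^+ 2.

Lemma l1_slopeZ z s y : 0 <= s ->
  l1_slope z (s%:C%C *: y) = s * l1_slope z y.
Proof.
move=> s0; rewrite /l1_slope mulr_sumr; apply: eq_bigr => j _.
by rewrite mxE normc_slopeZ.
Qed.

Lemma l1_driftZ z s y : l1_drift z (s%:C%C *: y) = s ^+ 2 * l1_drift z y.
Proof.
rewrite /l1_drift mulr_sumr; apply: eq_bigr => j _.
by rewrite mxE normc_driftZ exprMn.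
Qed.

Lemma l1_drift_ge0 z y : 0 <= l1_drift z y.
Proof. by apply: sumr_ge0 => j _; exact: sqr_ge0. Qed.

Lemma normc_le_l1norm y j : normc (y ord0 j) <= `|y|.
Proof.
rewrite l1normE (bigD1 j) //= lerDl; apply: sumr_ge0 => i _.
exact: normc_ge0.
Qed.

Lemma l1normB_ge z y B : 0 < B -> `|z| + `|y| <= B ->
  `|z| + l1_slope z y + l1_drift z y / (2 * B) <= `|z - y|.
Proof.
move=> B0 leB; rewrite !l1normE mulr_suml -!big_split /=.
apply: ler_sum => j _; rewrite !mxE; apply: normcB_ge => //.
by apply: le_trans leB; apply: lerD; exact: normc_le_l1norm.
Qed.

Lemma l1normB_le z y : exists2 s0, 0 < s0 & forall s, 0 <= s <= s0 ->
  `|z - s%:C%C *: y| <= `|z| + s * l1_slope z y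
    + s ^+ 2 * \sum_(j < n) normc_drift (z ord0 j) (y ord0 j) ^+ 2
                            / normc (z ord0 j).
Proof.
(* The condition [s * q j <= 1] is the smallness needed at a nonzero [z_j]; where [z_j = 0], [q j]
   is 0 by the convention for inverses. The inverse of 1 plus the sum serves all [j] at once. *)
set q := fun j : 'I_n => 2 * normc (y ord0 j) / normc (z ord0 j).
have q0 j : 0 <= q j by rewrite divr_ge0 ?mulr_ge0 ?normc_ge0.
have Q0 : 0 < 1 + \sum_j q j by rewrite ltr_wpDr // sumr_ge0.
exists (1 + \sum_j q j)^-1; first by rewrite invr_gt0.
move=> s /andP[s0 sle]; rewrite !l1normE !mulr_sumr -!big_split /=.
apply: ler_sum => j _; rewrite !mxE; apply: normcB_le => //.
have [->|z0] := eqVneq (z ord0 j) 0; [by right|left].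
have : s * q j <= 1.
  rewrite -[leRHS](@mulVf _ (1 + \sum_j q j)) ?gt_eqF //.
  apply: ler_pM => //; rewrite (bigD1 j) //= addrCA lerDl addr_ge0 //.
  exact: sumr_ge0.
by rewrite mulrA ler_pdivrMr ?normc_gt0 // mul1r mulrCA mulrA.
Qed.

Lemma l1_slope_ge0 z y :
  (forall s : R, `|z| <= `|z - s%:C%C *: y|) -> 0 <= l1_slope z y.
Proof.
have [s0 s0_gt0] := l1normB_le z y; set E := \sum_(j < n) _ => zy zle.
have E0 : 0 <= E.
  by apply: sumr_ge0 => j _; rewrite divr_ge0 ?sqr_ge0 ?normc_ge0.
rewrite leNgt; apply/negP => D0; set D := l1_slope z y in zy D0.
(* For this s, sD + s^2 E <= -s^2 < 0, so a negative slope would make the norm drop below |z|. *)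
pose s := Num.min s0 (- D / (E + 1)).
have s_gt0 : 0 < s by rewrite lt_min s0_gt0 divr_gt0 //; lra.
have sE : s * (E + 1) <= - D.
  by rewrite -ler_pdivlMr ?ge_min ?lexx ?orbT //; lra.
have := zy s; rewrite (ltW s_gt0) ge_min lexx => /(_ isT).
move/(le_trans (zle s)); nra.
Qed.

Lemma l1_slope_drift_eq0 z y : l1_slope z y = 0 -> l1_drift z y = 0 ->
  exists2 s : R, 0 < s & `|z - s%:C%C *: y| <= `|z|.
Proof.
move=> D0 Q0; have [s s_gt0 /(_ s)] := l1normB_le z y.
rewrite D0 big1 => [|j _].
  by rewrite lexx ltW // !mulr0 !addr0 => /(_ isT); exists s.
(* A vanishing sum of squares makes each drift zero, hence also the differently weighted sum in the
   upper bound. *)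
have/eqP := Q0; rewrite psumr_eq0 => [|i _]; last exact: sqr_ge0.
by move=> /allP/(_ j); rewrite mem_index_enum => /(_ isT)/eqP ->; rewrite mul0r.
Qed.

End L1Expansion.

(** * Continuity of sums and products of real functions *)

Section PointwiseContinuity.
Variables (R : realType) (T : topologicalType).
Implicit Types f g : T -> R.

Lemma continuous_sum (I : Type) (r : seq I) (P : pred I) (F : I -> T -> R) :
  (forall i, P i -> continuous (F i)) ->
  continuous (fun t => \sum_(i <- r | P i) F i t).
Proof. by apply: continuous_big; exact: add_continuous. Qed.

Lemma continuous_add f g : continuous f -> continuous g ->
  continuous (fun t => f t + g t).
Proof. by move=> cf cg t; exact: cvgD (cf t) (cg t). Qed.

Lemma continuous_mul f g : continuous f -> continuous g ->
  continuous (fun t => f t * g t).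
Proof. by move=> cf cg t; exact: cvgM (cf t) (cg t). Qed.

Lemma continuous_mulr f (a : R) : continuous f ->
  continuous (fun t => f t * a).
Proof. by move=> cf; apply: continuous_mul cf _ => t; exact: cvg_cst. Qed.

End PointwiseContinuity.

(** * Real coordinates on a complex span, which move the compactness argument to a real row space *)

Section RealCombination.
Variables (R : realType) (n d : nat) (b : 'I_d -> l1 R n).
Implicit Types (v : 'rV[R]_(d + d)) (s : R).

(* v lists the real parts, then the imaginary parts of the coefficients. *)
Definition real_comb v : l1 R n :=
  \sum_(i < d) (Complex (v ord0 (lshift d i)) (v ord0 (rshift d i))) *: b i.

Lemma real_combZ s v : real_comb (s *: v) = s%:C%C *: real_comb v.
Proof.
rewrite /real_comb scaler_sumr; apply: eq_bigr => i _.
rewrite scalerA; congr (_ *: _); rewrite !mxE.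
by rewrite /GRing.mul /= !mul0r subr0 addr0.
Qed.

Lemma real_comb_coord v j : real_comb v ord0 j = \sum_(i < d)
  Complex (v ord0 (lshift d i)) (v ord0 (rshift d i)) * b i ord0 j.
Proof. by rewrite summxE; apply: eq_bigr => i _; rewrite mxE. Qed.

Lemma continuous_Re_real_comb j :
  continuous (fun v => complex.Re (real_comb v ord0 j)).
Proof.
have -> : (fun v => complex.Re (real_comb v ord0 j)) = fun v =>
   \sum_(i < d) (v ord0 (lshift d i) * complex.Re (b i ord0 j)
                 + v ord0 (rshift d i) * - complex.Im (b i ord0 j)).
  apply/funext => v; rewrite real_comb_coord raddf_sum.
  by apply: eq_bigr => i _; case: (b i ord0 j) => p q /=; rewrite mulrN.
by apply: continuous_sum => i _; apply: continuous_add; apply: continuous_mulr;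
  exact: coord_continuous.
Qed.

Lemma continuous_Im_real_comb j :
  continuous (fun v => complex.Im (real_comb v ord0 j)).
Proof.
have -> : (fun v => complex.Im (real_comb v ord0 j)) = fun v =>
   \sum_(i < d) (v ord0 (lshift d i) * complex.Im (b i ord0 j)
                 + v ord0 (rshift d i) * complex.Re (b i ord0 j)).
  apply/funext => v; rewrite real_comb_coord raddf_sum.
  by apply: eq_bigr => i _; case: (b i ord0 j).
by apply: continuous_sum => i _; apply: continuous_add; apply: continuous_mulr;
  exact: coord_continuous.
Qed.

Lemma continuous_normc_real_comb j :
  continuous (fun v => normc (real_comb v ord0 j)).
Proof.
have -> : (fun v => normc (real_comb v ord0 j)) = Num.sqrt \o (fun v =>
   complex.Re (real_comb v ord0 j) * complex.Re (real_comb v ord0 j)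
   + complex.Im (real_comb v ord0 j) * complex.Im (real_comb v ord0 j)).
  by apply/funext => v /=; case: (real_comb v ord0 j).
move=> v; apply: continuous_comp; last exact: sqrt_continuous.
by apply: continuous_add; apply: continuous_mul;
  first [exact: continuous_Re_real_comb | exact: continuous_Im_real_comb].
Qed.

Lemma continuous_l1_slope z : continuous (fun v => l1_slope z (real_comb v)).
Proof.
apply: continuous_sum => j _; case: (z ord0 j) => p q.
have -> : (fun v => normc_slope (Complex p q) (real_comb v ord0 j)) =
  fun v => normc (real_comb v ord0 j) * (Complex p q == 0)%:R
    + (complex.Re (real_comb v ord0 j) * (- p / normc (Complex p q))
       + complex.Im (real_comb v ord0 j) * (- q / normc (Complex p q))).
  apply/funext => v; rewrite /normc_slope.
  case: (real_comb v ord0 j) => r t; rewrite [complex.Re (_ * _)]/=.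
  rewrite [complex.Re _]/= [complex.Im _]/=; ring.
apply: continuous_add; first exact/continuous_mulr/continuous_normc_real_comb.
by apply: continuous_add; apply: continuous_mulr;
  first [exact: continuous_Re_real_comb | exact: continuous_Im_real_comb].
Qed.

Lemma continuous_l1_drift z : continuous (fun v => l1_drift z (real_comb v)).
Proof.
apply: continuous_sum => j _; case: (z ord0 j) => p q.
suff cdrift : continuous
    (fun v => normc_drift (Complex p q) (real_comb v ord0 j)).
  under [X in continuous X]eq_fun do rewrite expr2.
  exact: continuous_mul.
have -> : (fun v => normc_drift (Complex p q) (real_comb v ord0 j)) =
  fun v => complex.Im (real_comb v ord0 j) * (p / normc (Complex p q))
    + complex.Re (real_comb v ord0 j) * (- q / normc (Complex p q)).
  apply/funext => v; rewrite /normc_drift.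
  case: (real_comb v ord0 j) => r t; rewrite [complex.Im (_ * _)]/=.
  rewrite [complex.Re _]/= [complex.Im _]/=; ring.
by apply: continuous_add; apply: continuous_mulr;
  first [exact: continuous_Re_real_comb | exact: continuous_Im_real_comb].
Qed.

(** The norm of [v] is the sup norm, so a coefficient p + iq has modulus at most |p| + |q| <=
    2|v|. *)
Lemma real_comb_le v : `|real_comb v| <= (2 * \sum_(i < d) `|b i|) * `|v|.
Proof.
have coord_le i : `|v ord0 i| <= `|v|.
  rewrite [leRHS]mx_normrE.
  exact: (le_bigmax _ (fun k => `|v k.1 k.2|) (ord0, i)).
apply: le_trans (ler_norm_sum _ _ _) _; rewrite mulr_sumr mulr_suml.
apply: ler_sum => i _; rewrite l1normZ mulrAC; apply: ler_wpM2r => //.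
apply: le_trans (normc_Complex_le _ _) _.
by rewrite mulr_natl mulr2n lerD.
Qed.

End RealCombination.

(** * Compactness of the unit sphere, and coordinates in a basis of [Y] *)

Lemma unit_sphere_lower_bound (R : realType) m (F : 'rV[R]_m -> R) :
  continuous F -> (forall v, v != 0 -> 0 < F v) ->
  exists2 k, 0 < k & forall v, `|v| = 1 -> k <= F v.
Proof.
move=> cF F0; pose S := [set v : 'rV[R]_m | `|v| = 1]%classic.
(* The sphere is empty when [m] is 0, and any positive bound then works. *)
have [S0|S0] := pselect (S !=set0)%classic; last first.
  by exists 1 => // v v1; case: S0; exists v.
have cS : compact S.
  apply: bounded_closed_compact.
    by exists 1; split => // M M1 v /= ->; exact: ltW.
  have -> : S = (@Num.norm _ 'rV[R]_m @^-1` [set 1])%classic by [].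
  apply: closed_comp; last exact: closed_eq.
  by move=> v _; exact: norm_continuous.
have [c cS1 cmin] := EVT_min_rV S0 cS (continuous_subspaceT cF).
exists (F c) => [|v v1]; last by apply: cmin; rewrite inE.
by apply: F0; move: cS1; rewrite inE /S /= -normr_gt0 => ->.
Qed.

Lemma vbasis_real_comb (R : realType) n (Y : {vspace l1 R n}) y :
  y \in Y -> exists v, real_comb (fun i : 'I_(\dim Y) => (vbasis Y)`_i) v = y.
Proof.
move=> /coord_vbasis yE.
exists (row_mx (\row_(i < \dim Y) complex.Re (coord (vbasis Y) i y))
               (\row_(i < \dim Y) complex.Im (coord (vbasis Y) i y))).
rewrite [RHS]yE; apply: eq_bigr => i _; rewrite row_mxEl row_mxEr !mxE.
by case: (coord _ _ _).
Qed.

Lemma real_comb_vbasis_mem (R : realType) n (Y : {vspace l1 R n}) v :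
  real_comb (fun i : 'I_(\dim Y) => (vbasis Y)`_i) v \in Y.
Proof.
apply: memv_suml => i _; apply: memvZ; apply: vbasis_mem.
by rewrite mem_nth // size_tuple.
Qed.

Lemma real_comb_vbasis_eq0 (R : realType) n (Y : {vspace l1 R n}) v :
  real_comb (fun i : 'I_(\dim Y) => (vbasis Y)`_i) v = 0 -> v = 0.
Proof.
move/freeP: (basis_free (vbasisP Y)) => freeY /freeY v0.
apply/rowP => i; rewrite mxE -(splitK i).
by case: (split i) => k /=; case: (v0 k).
Qed.

(** * Strong uniqueness at the origin, then the general case by translation *)

Lemma best_approximation_strong (R : realType) n (Y : {vspace l1 R n})
    (z : l1 R n) :
  (forall y, y \in Y -> `|z| <= `|z - y|) ->
  (forall y, y \in Y -> `|z - y| <= `|z| -> y = 0) ->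
  exists2 r : R, 0 < r &
    forall y, y \in Y -> `|z| ^+ 2 + r * `|y| ^+ 2 <= `|z - y| ^+ 2.
Proof.
move=> zbest zuniq; have [->|z0] := eqVneq z 0.
  exists 1 => // y _.
  by rewrite normr0 expr0n add0r mul1r sub0r normrN.
have N0 : 0 < `|z| by rewrite normr_gt0.
set N := `|z| in zbest zuniq N0 *.
pose Yc := real_comb (fun i : 'I_(\dim Y) => (vbasis Y)`_i).
have [C C0 Cle] : exists2 C, 0 < C & forall v, `|Yc v| <= C * `|v|.
  exists (1 + 2 * \sum_(i < \dim Y) `|(vbasis Y)`_i : l1 R n|).
    by rewrite ltr_wpDr // mulr_ge0 // sumr_ge0.
  move=> v; apply: le_trans (real_comb_le _ _) _.
  by rewrite ler_wpM2r // lerDr.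
have YcY v : Yc v \in Y by exact: real_comb_vbasis_mem.
have D0 v : 0 <= l1_slope z (Yc v).
  by apply: l1_slope_ge0 => s; apply: zbest; exact: memvZ.
(* The weight is the drift coefficient of the lower expansion with B = N + C, a bound valid for all
   |v| <= 1. *)
pose F v := l1_slope z (Yc v) + l1_drift z (Yc v) * (2 * (N + C))^-1.
have B0 : 0 < 2 * (N + C) by rewrite mulr_gt0 ?addr_gt0.
have cF : continuous F.
  apply: continuous_add; first exact: continuous_l1_slope.
  exact/continuous_mulr/continuous_l1_drift.
have F_gt0 v : v != 0 -> 0 < F v.
  move=> v0; have Q0 := l1_drift_ge0 z (Yc v).
  have BQ0 : 0 <= l1_drift z (Yc v) * (2 * (N + C))^-1.
    by rewrite divr_ge0 // ltW.
  rewrite lt0r addr_ge0 // andbT paddr_eq0 //; apply/negP => /andP[/eqP De].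
  rewrite mulf_eq0 invr_eq0 (gt_eqF B0) orbF => /eqP Qe.
  have [s s_gt0 /zuniq] := l1_slope_drift_eq0 De Qe.
  move=> /(_ (memvZ _ (YcY v)))/eqP; rewrite scaler_eq0 => /orP[/eqP[] sE|].
    by rewrite sE ltxx in s_gt0.
  by move/eqP/real_comb_vbasis_eq0/eqP; rewrite (negbTE v0).
have [k k0 kF] := unit_sphere_lower_bound cF F_gt0.
have linear_or_quadratic v : `|v| <= 1 /\ N + k * `|v| ^+ 2 <= `|z - Yc v|
    \/ N + k * `|v| <= `|z - Yc v|.
  set t := `|v|; have t_ge0 : 0 <= t := normr_ge0 v.
  have [tE|t0] := eqVneq t 0.
    by right; rewrite tE mulr0 addr0; exact: zbest.
  have t_gt0 : 0 < t by rewrite lt0r t0.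
  have Bt : 0 < N + C * t by rewrite addr_gt0 // mulr_gt0.
  have := l1normB_ge Bt (lerD (lexx N) (Cle v)).
  pose u := t^-1 *: v.
  have u1 : `|u| = 1 by rewrite normrZ normfV (ger0_norm t_ge0) mulVf.
  have -> : Yc v = t%:C%C *: Yc u.
    by rewrite -real_combZ /u scalerA mulfV // scale1r.
  rewrite l1_slopeZ // l1_driftZ.
  have := kF _ u1; rewrite /F; have := D0 u; have := l1_drift_ge0 z (Yc u).
  set D := l1_slope _ _; set Q := l1_drift _ _; set f := `|_ - _|.
  move=> Q_ge0 D_ge0 kle fge.
  (* The gain is tD + t^2 Q / (2(N + Ct)). For t <= 1 it is at least t^2 F(u), as tD >= t^2 D and N
     + Ct <= N + C; for t > 1 it is at least t F(u), as N + Ct <= t(N + C). *)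
  have [t1|t1] := leP t 1; [left; split=> //|right]; apply: le_trans fge.
    have invB : (2 * (N + C))^-1 <= (2 * (N + C * t))^-1.
      have : 0 <= C * (1 - t) by rewrite mulr_ge0 ?subr_ge0 // ltW.
      by rewrite lef_pV2 ?posrE ?mulr_gt0 ?addr_gt0 ?mulr_gt0 //; lra.
    rewrite -addrA lerD2l -mulrA.
    apply: (@le_trans _ _ (t ^+ 2 * (D + Q * (2 * (N + C))^-1))).
      by rewrite mulrC ler_wpM2l // sqr_ge0.
    rewrite mulrDr; apply: lerD; last by rewrite !ler_wpM2l ?sqr_ge0.
    by rewrite ler_wpM2r // expr2 ler_piMl.
  have invB : (2 * (N + C))^-1 <= t * (2 * (N + C * t))^-1.
    rewrite -[leLHS]mul1r ler_pdivrMr // mulrAC ler_pdivlMr ?mulr_gt0 //.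
    nra.
  rewrite -addrA lerD2l.
  apply: (@le_trans _ _ (t * (D + Q * (2 * (N + C))^-1))).
    by rewrite mulrC ler_wpM2l.
  by rewrite mulrDr lerD2l expr2 -!mulrA ler_wpM2l // mulrCA ler_wpM2l.
(* Squaring N + kt^2 gains at least 2Nk t^2, squaring N + kt at least k^2 t^2; dividing by C^2
   passes from the norm of [v] to that of [Yc v]. *)
exists (Num.min (2 * N * k) (k ^+ 2) / C ^+ 2).
  by rewrite divr_gt0 ?exprn_gt0 // lt_min !mulr_gt0 ?exprn_gt0.
move=> y /vbasis_real_comb[v <-]; rewrite -/(Yc v).
set r := Num.min _ _.
have r1 : r <= 2 * N * k by rewrite ge_min lexx.
have r2 : r <= k ^+ 2 by rewrite ge_min lexx orbT.
have r0 : 0 <= r by rewrite le_min !mulr_ge0 ?sqr_ge0 // ltW.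
have t0 : 0 <= `|v| := normr_ge0 v.
apply: (@le_trans _ _ (N ^+ 2 + r * `|v| ^+ 2)).
  rewrite lerD2l -mulrA ler_wpM2l // mulrC ler_pdivrMr ?exprn_gt0 //.
  by rewrite mulrC -exprMn ler_sqr ?nnegrE // mulr_ge0 // ltW.
have [[_]|] := linear_or_quadratic v.
  set t := `|v| in t0 *; set f := `|_ - _| => fge.
  apply: (@le_trans _ _ ((N + k * t ^+ 2) ^+ 2)).
    have := ler_wpM2r (sqr_ge0 t) r1; have := sqr_ge0 (k * t ^+ 2); nra.
  by rewrite ler_sqr ?nnegrE ?normr_ge0 // addr_ge0 ?mulr_ge0 ?sqr_ge0 //
    ltW.
set t := `|v| in t0 *; set f := `|_ - _| => fge.
apply: (@le_trans _ _ ((N + k * t) ^+ 2)).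
  have := ler_wpM2r (sqr_ge0 t) r2; have : 0 <= N * (k * t).
    by rewrite !mulr_ge0 // ltW.
  nra.
by rewrite ler_sqr ?nnegrE ?normr_ge0 // addr_ge0 ?mulr_ge0 // ltW.
Qed.

Theorem theorem3p9 (R : realType) (n : nat) (hn : (2 <= n)%N)
    (Y : {vspace l1 R n}) (hY0 : Y <> 0%VS) (hYT : Y <> fullv)
    (x y0 : l1 R n) :
  unique_best_approximation Y x y0 ->
  strongly_unique_best_approximation 2 Y x y0.
Proof.
move=> [[y0Y y0best] y0uniq].
have shift y : x - (y0 + y) = x - y0 - y by rewrite opprD addrA.
have [y yY|y yY yle|r r0 rle] := @best_approximation_strong _ _ Y (x - y0).
- by rewrite -shift; apply: y0best; exact: memvD.
(* If subtracting [y] does not increase the norm of [x - y0], then [y0 + y] is also a best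
   approximation, hence equals [y0]. *)
- apply: (addrI y0); rewrite addr0; apply: y0uniq; split; first exact: memvD.
  by move=> w wY; rewrite shift; apply: le_trans yle (y0best _ wY).
split=> //; exists r; split=> // y yY.
have := rle (y - y0) (memvB yY y0Y); rewrite -shift [y0 + _]addrC subrK.
by rewrite !powR_mulrn.
Qed.
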